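(* There exist constants $C > 0$ and $N_0$ such that for every integer $N \ge N_0$ there are disjoint nonempty sets $\mathcal{X}, \mathcal{Y} \subseteq \{1,\ldots,N\}$ consisting of primes such that, if $X$ and $Y$ are independent random variables uniformly distributed on $\mathcal{X}$ and $\mathcal{Y}$ respectively, then $$H(X,Y\mid X\cdot Y) = 0,\qquad \log_2 N - H(X) \le C\log\log N,\qquad \log_2 N - H(Y) \le C\log\log N.$$
   Context: $X \cdot Y$ denotes the ordinary integer product. $H$ denotes Shannon entropy with logarithms to base 2. $H(X,Y\mid X\cdot Y)$ is the conditional entropy (equivocation) of the ordered pair $(X,Y)$ given the product $X\cdot Y$; since $X \cdot Y$ is determined by $(X,Y)$, it equals $H(X,Y) - H(X\cdot Y)$. *)

(* Defs.v *)
From HB Require Import structures.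
From mathcomp Require Import all_boot all_order all_algebra finmap.
From mathcomp Require Import all_classical all_reals all_analysis.

Set Implicit Arguments.
Unset Strict Implicit.
Unset Printing Implicit Defensive.
Import Order.TTheory GRing.Theory Num.Theory.
Import numFieldNormedType.Exports.

Local Open Scope classical_set_scope.
Local Open Scope ring_scope.

Definition log2 (R : realType) (x : R) : R := ln x / ln 2.

(* Entropy of a mass function on a discrete type. For values in [0, 1] every
   term is nonnegative, so the unordered sum is well defined, possibly +oo;
   the convention 0 log 0 = 0 is automatic. *)
Definition shannon (R : realType) (U : choiceType) (p : U -> R) : \bar R :=
  (\esum_(u in [set: U]) (- (p u * log2 (p u)))%:E)%E.

(* Discrete random variables are given here as plain functions, so that (X, Y)
   and X * Y need no bundling; the definitions are meaningful when the
   preimages of points are measurable. *)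
Definition mass d (T : measurableType d) (R : realType) (P : probability T R)
    (U : Type) (Z : T -> U) (u : U) : R :=
  fine (P (Z @^-1` [set u])).

Definition entropy d (T : measurableType d) (R : realType)
    (P : probability T R) (U : choiceType) (Z : T -> U) : \bar R :=
  shannon (mass P Z).

(* P(Z = u | W = v), equal to 0 when P(W = v) = 0. *)
Definition cond_mass d (T : measurableType d) (R : realType)
    (P : probability T R) (U V : Type) (Z : T -> U) (W : T -> V)
    (v : V) (u : U) : R :=
  fine (P (Z @^-1` [set u] `&` W @^-1` [set v])) / mass P W v.

(* H(Z | W) = sum_v P(W = v) H(Z | W = v). *)
Definition cond_entropy d (T : measurableType d) (R : realType)
    (P : probability T R) (U V : choiceType) (Z : T -> U) (W : T -> V)
    : \bar R :=
  (\esum_(v in [set: V]) ((mass P W v)%:E * shannon (cond_mass P Z W v)))%E.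

Definition independent_RVs d (T : measurableType d) (R : realType)
    (P : probability T R) d1 (T1 : measurableType d1)
    d2 (T2 : measurableType d2)
    (X : {RV P >-> T1}) (Y : {RV P >-> T2}) : Prop :=
  forall (A : set T1) (B : set T2), measurable A -> measurable B ->
    P (X @^-1` A `&` Y @^-1` B) = (P (X @^-1` A) * P (Y @^-1` B))%E.

(* Meaningful for nonempty A. *)
Definition uniform_on d (T : measurableType d) (R : realType)
    (P : probability T R) (X : {RV P >-> nat}) (A : {fset nat}) : Prop :=
  forall k : nat,
    P (X @^-1` [set k]) = (if k \in A then (#|` A|%fset%:R : R)^-1 else 0)%:E.

(* Main.v *)
Require Import Defs.
From HB Require Import structures.
From mathcomp Require Import all_boot all_order all_algebra finmap.
From mathcomp Require Import all_classical all_reals all_analysis.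
From mathcomp Require Import zify ring lra.

Set Implicit Arguments.
Unset Strict Implicit.
Unset Printing Implicit Defensive.
Import Order.TTheory GRing.Theory Num.Theory.
Import numFieldNormedType.Exports.

(** Take the primes up to N and cut the list into two halves A and B. By unique
    factorization a product x * y with x in A and y in B determines the pair
    (x, y) ([disjoint_prime_product_inj]): disjointness is what tells the two
    factors apart. Hence, up to a null event, (X, Y) is a function of X * Y, and
    its conditional entropy vanishes ([cond_entropy_determined_eq0]).

    A uniform variable on A has entropy log2 |A| ([entropy_uniform_on]), so the
    entropy deficits are small as soon as the primes up to N are numerous. A
    bound pi(N) >= c N / ln N suffices, since a power of ln N costs only a
    multiple of ln ln N ([log2_gap]). It follows from Chebyshev's argument on
    the central binomial coefficient: 2^floor(n/2) <= C(n, floor(n/2))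
    ([leq_exp2_bin]), while each prime power dividing C(n, k) is at most n
    ([logn_bin_le]), so that C(n, k) <= n^pi(n) ([bin_le_exp_primes]). *)

Definition primes_upto (n : nat) : seq nat := [seq p <- iota 1 n | prime p].

(** Going from C(n-1, k) to C(n, k+1) multiplies by n / (k+1), a factor at
    least 2 as long as the lower index stays at most half of the upper one. *)
Lemma leq_exp2_bin n k : k.*2 <= n -> 2 ^ k <= 'C(n, k).
Proof.
elim: k n => [|k IHk] [|n] //= le_kn; rewrite ?bin0 //.
have IH : 2 ^ k <= 'C(n, k) by apply: IHk; lia.
have := mul_bin_diag n.+1 k => /= E.
rewrite -(leq_pmul2l (ltn0Sn k)) -E expnS; nia.
Qed.

Lemma divnD_le_succ d m n : (m + n) %/ d <= m %/ d + n %/ d + 1.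
Proof.
case: (posnP d) => [->|d_gt0]; first by rewrite !divn0.
by rewrite divnD// leq_add2l leq_b1.
Qed.

(** Legendre's formula writes the exponent of p in C(n, k) as a sum over i of
    floor(n / p^i) - floor(k / p^i) - floor((n-k) / p^i). Each term is at most
    1, and it vanishes once p^i > n. *)
Lemma logn_bin_le p n k : prime p -> k <= n ->
  logn p 'C(n, k) <= trunc_log p n.
Proof.
move=> p_pr le_kn.
set t := trunc_log p n.
have p_gt1 := prime_gt1 p_pr.
(* Legendre sums truncated at a common index, so that they can be combined
   termwise. *)
have fact_sum m : m <= n -> logn p m`! = \sum_(1 <= i < t.+1) m %/ p ^ i.
  move=> le_mn; rewrite logn_fact//.
  have small i : t.+1 <= i -> m %/ p ^ i = 0.
    move=> lt_ti; apply: divn_small; apply: (leq_ltn_trans le_mn).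
    by apply: (leq_trans (trunc_log_ltn n p_gt1)); rewrite leq_pexp2l// ltnW.
  have small' i : m.+1 <= i -> m %/ p ^ i = 0.
    move=> lt_mi; apply: divn_small; apply: (leq_trans lt_mi).
    by rewrite ltnW// ltn_expl.
  case: (leqP m t) => [le_mt|/ltnW le_tm].
    rewrite [RHS](big_cat_nat (n:=m.+1))//= [X in _ = _ + X]big1_seq ?addn0//.
    by move=> i; rewrite mem_index_iota => /and3P[_ + _]; exact: small'.
  rewrite [LHS](big_cat_nat (n:=t.+1))//= [X in _ + X]big1_seq ?addn0//.
  by move=> i; rewrite mem_index_iota => /and3P[_ + _]; exact: small.
have := congr1 (logn p) (bin_fact le_kn).
rewrite !lognM ?muln_gt0 ?fact_gt0 ?bin_gt0// !fact_sum ?leq_subr// => E.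
rewrite -(leq_add2r (\sum_(1 <= i < t.+1) k %/ p ^ i +
  \sum_(1 <= i < t.+1) (n - k) %/ p ^ i)) E.
rewrite -{2}[t]subn0 -subSS -[t.+1 - 1]muln1 -sum_nat_const_nat -!big_split/=.
apply: leq_sum => i _.
have := divnD_le_succ (p ^ i) k (n - k); rewrite subnKC//; lia.
Qed.

(** Every prime power in the factorization of C(n, k) is at most n, and the
    primes that occur are at most n. *)
Lemma bin_le_exp_primes n k : k <= n -> 'C(n, k) <= n ^ size (primes_upto n).
Proof.
move=> le_kn.
have C_gt0 : 0 < 'C(n, k) by rewrite bin_gt0.
have [n0|n_gt0] := posnP n.
  by move: le_kn; rewrite n0 leqn0 => /eqP ->.
have pow_le p : prime p -> p ^ logn p 'C(n, k) <= n.
  move=> p_pr; apply: leq_trans (trunc_logP (prime_gt1 p_pr) n_gt0).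
  by rewrite leq_pexp2l ?prime_gt0// logn_bin_le.
rewrite {1}(prod_prime_decomp C_gt0) prime_decompE big_map/=.
apply: (@leq_trans (n ^ size (primes 'C(n, k)))).
  rewrite -sum1_size expn_sum big_seq [leqRHS]big_seq.
  by apply: leq_prod => p; rewrite mem_primes => /andP[/pow_le + _]; rewrite expn1.
rewrite leq_pexp2l//; apply: uniq_leq_size (primes_uniq _) _ => p.
rewrite mem_primes mem_filter mem_iota => /and3P[p_pr _ p_dvd].
rewrite p_pr prime_gt0//= add1n ltnS.
apply: leq_trans (pow_le p p_pr).
have e_gt0 : 0 < logn p 'C(n, k) by rewrite logn_gt0 mem_primes p_pr C_gt0.
by have := leq_pexp2l (prime_gt0 p_pr) e_gt0; rewrite expn1.
Qed.

(** Chebyshev's lower bound in multiplicative form: it amounts to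
    pi(n) >= floor(n/2) log 2 / log n. *)
Lemma exp2_half_le_exp_primes n : 2 ^ n./2 <= n ^ size (primes_upto n).
Proof.
apply: (@leq_trans 'C(n, n./2)); first by apply: leq_exp2_bin; lia.
by apply: bin_le_exp_primes; lia.
Qed.

Local Open Scope classical_set_scope.
Local Open Scope ring_scope.

(** If W determines Z on an event D of full measure, then for each value v of
    positive mass the conditional law of Z given W = v is a point mass: an
    atom {Z = u, W = v} either meets D, and then it fills {W = v} up to the
    complement of D, or it lies in that complement. Values v of mass zero carry
    weight zero. *)
Lemma cond_entropy_determined_eq0 d (T : measurableType d) (R : realType)
    (P : probability T R) (U V : choiceType) (Z : T -> U) (W : T -> V)
    (D : set T) :
  (forall u, measurable (Z @^-1` [set u])) ->
  (forall v, measurable (W @^-1` [set v])) ->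
  measurable D -> P (~` D) = 0%E ->
  (forall w w', D w -> D w' -> W w = W w' -> Z w = Z w') ->
  cond_entropy P Z W = 0%E.
Proof.
move=> mZ mW mD PD0 detZ; apply: esum1 => v _.
have [->|mass_neq0] := eqVneq (mass P W v) 0; first by rewrite mul0e.
rewrite [X in (_ * X)%E]esum1 ?mule0// => u _.
have mZW : measurable (Z @^-1` [set u] `&` W @^-1` [set v]) by apply: measurableI.
have mDC : measurable (~` D) by apply: measurableC.
have mU := measurableU _ _ mZW mDC.
rewrite /cond_mass /log2.
have [[w [[Zw Ww] Dw]]|no_w] :=
    pselect (Z @^-1` [set u] `&` W @^-1` [set v] `&` D !=set0).
  suff -> : P (Z @^-1` [set u] `&` W @^-1` [set v]) = P (W @^-1` [set v]).
    by rewrite -/(mass P W v) divff// ln1 mul0r mulr0 oppr0.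
  apply/eqP; rewrite eq_le; apply/andP; split.
    by apply: le_measure; rewrite ?inE//; exact: subIsetr.
  rewrite -(measureU0 mZW mDC PD0).
  apply: le_measure; rewrite ?inE// => w' Ww'.
  have [Dw'|] := pselect (D w'); last by right.
  left; split => //=; rewrite -Zw; apply: detZ => //.
  by rewrite Ww Ww'.
rewrite (@subset_measure0 _ _ _ _ _ (~` D))//; first by rewrite !mul0r oppr0.
by move=> w ZWw Dw; apply: no_w; exists w.
Qed.

(** Uniformity only constrains the mass of single points, so the values outside
    A are dealt with one by one, as a countable union of null sets. *)
Lemma uniform_on_supp d (T : measurableType d) (R : realType)
    (P : probability T R) (X : {RV P >-> nat}) (A : {fset nat}) :
  uniform_on X A -> P (~` (X @^-1` [set` A])) = 0%E.
Proof.
move=> unifX.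
have mA : measurable (~` (X @^-1` [set` A])).
  by apply: measurableC; apply: measurable_funPTI.
apply: measure_negligible => //.
have sub : ~` (X @^-1` [set` A]) `<=` \bigcup_k X @^-1` ([set k] `\` [set` A]).
  by move=> w Aw; exists (X w).
apply: negligibleS sub _.
apply: negligible_bigcup => k.
have mk : measurable (X @^-1` ([set k] `\` [set` A])).
  exact: measurable_funPTI.
apply/negligibleP => //.
have [kA|kA] := boolP (k \in A).
  rewrite (_ : _ @^-1` _ = set0) ?measure0//; apply/seteqP; split => // w [/= ->].
  by rewrite kA.
apply: (@subset_measure0 _ _ _ _ _ (X @^-1` [set k])) => //.
- exact: measurable_funPTI.
- by move=> w [].
- by apply: etrans (unifX k) _; rewrite (negbTE kA).
Qed.

Lemma entropy_uniform_on d (T : measurableType d) (R : realType)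
    (P : probability T R) (X : {RV P >-> nat}) (A : {fset nat}) :
  uniform_on X A -> A != fset0 ->
  entropy P X = (log2 (#|` A|%:R))%:E.
Proof.
move=> unifX A_neq0.
have A_gt0 : (0 < #|` A|)%N by rewrite cardfs_gt0.
have A_pos : 0 < #|` A|%:R :> R by rewrite ltr0n.
pose h : R := #|` A|%:R^-1 * log2 (#|` A|%:R).
have h_ge0 : 0 <= h.
  by rewrite mulr_ge0 ?invr_ge0 ?(ltW A_pos)// divr_ge0// ln_ge0// ler1n.
transitivity (\esum_(k in [set: nat]) if k \in [set` A] then h%:E else 0%E).
  apply: eq_esum => k _; rewrite /mass (unifX k).
  case: ifPn => kA /=; last by rewrite memNset ?mul0r ?oppr0//=; apply/negP.
  by rewrite mem_set// /h /log2 lnV ?posrE// mulNr mulrN opprK.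
rewrite -esum_mkcond esum_fset; [|exact: finite_fset|by move=> k _; rewrite lee_fin].
rewrite -fsbig_seq ?fset_uniq// sumEFin big_const_seq count_predT iter_addr_0.
by rewrite -[(_ *+ _)]mulr_natl /h mulrA divff ?mul1r// gt_eqF.
Qed.

(** The prime x divides x' * y', and it cannot be y' because the two sets are
    disjoint; so x = x' by Euclid's lemma, and y = y' by cancellation. *)
Lemma disjoint_prime_product_inj (A B : {fset nat}) (x y x' y' : nat) :
  [disjoint A & B]%fset ->
  (forall p, p \in A -> prime p) -> (forall p, p \in B -> prime p) ->
  x \in A -> y \in B -> x' \in A -> y' \in B ->
  (x * y = x' * y')%N -> (x, y) = (x', y').
Proof.
move=> disAB prA prB xA yB x'A y'B E.
have x_pr := prA x xA; have x'_pr := prA _ x'A; have y'_pr := prB _ y'B.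
have : (x %| x' * y')%N by rewrite -E dvdn_mulr.
rewrite Euclid_dvdM// !dvdn_prime2// => /orP[/eqP ex|/eqP xy']; last first.
  by move/fdisjointP: disAB => /(_ x xA); rewrite xy' y'B.
move/eqP: E; rewrite ex eqn_pmul2l ?prime_gt0// => /eqP ->.
by [].
Qed.

(** Any m of at least half the number of primes up to N satisfies
    N <= (9 / ln 2) m ln N by Chebyshev's bound. Once ln N >= 9 / ln 2 the
    constant is absorbed in a second logarithm, giving N <= m (ln N)^2; the
    logarithm of this inequality is the claim. *)
Lemma log2_gap (R : realType) : exists N0 : nat, forall N : nat, (N0 <= N)%N ->
  (2 <= size (primes_upto N))%N /\
  forall m : nat, ((size (primes_upto N))./2 <= m)%N ->
  log2 (N%:R : R) - log2 (m%:R) <= 2 / ln 2 * ln (ln (N%:R)).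
Proof.
have ln2_gt0 : 0 < ln 2 :> R by rewrite ln_gt0// ltr1n.
(* 9 = 3 * 3: one factor from N <= 3 floor(N/2), one from
   pi(N) <= 3 floor(pi(N)/2), valid since N and pi(N) are at least 2. *)
set K : R := 9 / ln 2.
have K_gt0 : 0 < K by rewrite divr_gt0.
have [t ltKt] : exists t : nat, expR K < t%:R.
  by exists (Num.truncn (expR K)).+1; exact: truncnS_gt.
exists (t + 3)%N => N le_N.
have N_ge3 : (3 <= N)%N by lia.
have N_pos : 0 < N%:R :> R by rewrite ltr0n; lia.
have le_K : K <= ln N%:R.
  rewrite -[K]expRK ler_ln ?posrE ?expR_gt0//.
  apply: le_trans (ltW ltKt) _; rewrite ler_nat; lia.
have lnN_gt0 : 0 < ln N%:R :> R by exact: lt_le_trans le_K.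
have pi_ge2 : (2 <= size (primes_upto N))%N.
  apply: (@uniq_leq_size _ [:: 2; 3]%N) => // p.
  rewrite !inE mem_filter mem_iota => /orP[] /eqP ->; apply/andP; split => //; lia.
split => // m le_m.
have m_gt0 : (0 < m)%N by lia.
have m_pos : 0 < m%:R :> R by rewrite ltr0n.
have cheb : (N./2)%:R * ln 2 <= (size (primes_upto N))%:R * ln N%:R :> R.
  rewrite !mulr_natl -!lnXn// -!natrX ler_ln ?posrE ?ltr0n ?expn_gt0//.
    by rewrite ler_nat exp2_half_le_exp_primes.
  by apply/orP; left; lia.
have le_N3 : N%:R <= 3 * (N./2)%:R :> R by rewrite -natrM ler_nat; lia.
have le_pi3 : (size (primes_upto N))%:R <= 3 * m%:R :> R.
  by rewrite -natrM ler_nat; lia.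
have N_le : N%:R <= m%:R * ln N%:R ^+ 2 :> R.
  apply: (@le_trans _ _ (K * m%:R * ln N%:R)); last first.
    by rewrite expr2 mulrA ler_pM2r// mulrC ler_pM2l.
  rewrite (_ : K * _ * _ = 9 * (m%:R * ln N%:R) / ln 2); last by rewrite /K; ring.
  rewrite ler_pdivlMr//.
  have := ler_wpM2r (ltW ln2_gt0) le_N3.
  have := ler_wpM2r (ltW lnN_gt0) le_pi3.
  lra.
rewrite /log2 -mulrBl mulrAC ler_pM2r ?invr_gt0// lerBlDl mulr_natl.
by rewrite -lnXn// -lnM ?posrE ?exprn_gt0// ler_ln ?posrE// mulr_gt0 ?exprn_gt0.
Qed.

Theorem mainTheorem3 (R : realType) :
  exists (C : R) (N0 : nat), 0 < C /\
  forall N : nat, (N0 <= N)%N ->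
  exists A B : {fset nat},
    [/\ A != fset0, B != fset0, [disjoint A & B]%fset,
        (forall p : nat, p \in A -> (1 <= p <= N)%N /\ prime p) &
        (forall p : nat, p \in B -> (1 <= p <= N)%N /\ prime p)] /\
    forall (d : measure_display) (T : measurableType d) (P : probability T R)
           (X Y : {RV P >-> nat}),
      independent_RVs X Y -> uniform_on X A -> uniform_on Y B ->
      [/\ cond_entropy P (fun w => (X w, Y w)) (fun w => (X w * Y w)%N) = 0%E,
          ((log2 (N%:R : R))%:E - entropy P X <= (C * ln (ln (N%:R : R)))%:E)%E &
          ((log2 (N%:R : R))%:E - entropy P Y <= (C * ln (ln (N%:R : R)))%:E)%E].
Proof.
have [N0 gap] := log2_gap R.
exists (2 / ln 2), N0; split; first by rewrite divr_gt0// ln_gt0// ltr1n.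
move=> N /gap[pi_ge2 {}gap].
set S := primes_upto N in pi_ge2 gap *.
set h := (size S)./2 in gap *.
have [h_gt0 le_h2] : (0 < h)%N /\ (h + h <= size S)%N by rewrite /h; split; lia.
have le_h : (h <= size S - h)%N by rewrite leq_subRL; lia.
have uS : uniq S by rewrite filter_uniq// iota_uniq.
have /and3P[uA disS uB] : [&& uniq (take h S),
    ~~ has (mem (take h S)) (drop h S) & uniq (drop h S)].
  by rewrite -cat_uniq cat_take_drop.
pose A := [fset x in take h S]%fset; pose B := [fset x in drop h S]%fset.
have cA : #|` A| = h by rewrite card_fseq undup_id// size_takel// (leq_trans (leq_addl _ _) le_h2).
have cB : #|` B| = (size S - h)%N by rewrite card_fseq undup_id// size_drop.
have inS p : p \in S -> (1 <= p <= N)%N /\ prime p.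
  by rewrite mem_filter mem_iota add1n ltnS => /andP[].
have inA p : p \in A -> (1 <= p <= N)%N /\ prime p.
  by rewrite inE => /mem_take/inS.
have inB p : p \in B -> (1 <= p <= N)%N /\ prime p.
  by rewrite inE => /mem_drop/inS.
have A0 : A != fset0 by rewrite -cardfs_gt0 cA; lia.
have B0 : B != fset0 by rewrite -cardfs_gt0 cB; lia.
have disAB : [disjoint A & B]%fset.
  apply/fdisjointP => p; rewrite !inE => pA; apply/negP => pB.
  by move/hasP: disS; apply; exists p.
exists A, B; split=> // d T P X Y _ unifX unifY; split; last 2 first.
- by rewrite (entropy_uniform_on unifX)// lee_fin gap// cA.
- by rewrite (entropy_uniform_on unifY)// lee_fin gap// cB.
have mX (E : set nat) : measurable (X @^-1` E) by apply: measurable_funPTI.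
have mY (E : set nat) : measurable (Y @^-1` E) by apply: measurable_funPTI.
apply: (@cond_entropy_determined_eq0 _ _ _ _ _ _ _ _
  (X @^-1` [set` A] `&` Y @^-1` [set` B])).
- move=> [x y].
  rewrite (_ : _ @^-1` _ = X @^-1` [set x] `&` Y @^-1` [set y]).
    exact: measurableI.
  by apply/seteqP; split => w /= [-> ->].
- move=> v.
  rewrite (_ : _ @^-1` _ = \bigcup_k
      (X @^-1` [set k] `&` Y @^-1` [set y | (k * y)%N = v])).
    by apply: bigcup_measurable => k _; exact: measurableI.
  apply/seteqP; split => [w /= <-|w [k _ [/= -> //]]].
  by exists (X w).
- exact: measurableI.
- have mXC : measurable (~` (X @^-1` [set` A])) by exact: measurableC.
  have mYC : measurable (~` (Y @^-1` [set` B])) by exact: measurableC.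
  rewrite setCI (measureU0 mXC mYC (uniform_on_supp unifY)).
  exact: uniform_on_supp unifX.
- move=> w w' [/= xA yB] [/= x'A y'B].
  by apply: (disjoint_prime_product_inj disAB) => // p; [move/inA => []|move/inB => []].
Qed.
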